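(* Let $F$ be a field of characteristic $\neq 2$ and $\alpha,\beta,\gamma\in F^\times$. Let $V$ be the 7-dimensional $F$-vector space with basis $v_0,\dots,v_6$ (indices in $\mathbb{Z}/7\mathbb{Z}$), and let $l_n=\{v_n,v_{n+1},v_{n+3}\}$ ($n\in\mathbb{Z}/7$) be the lines of the Fano plane on these points. Fix $\varepsilon\in\{0,1\}$ and equip each line with the cyclic order $(v_n,v_{n+1},v_{n+3})$ if $\varepsilon=0$, resp. $(v_{n+1},v_n,v_{n+3})$ if $\varepsilon=1$ (the same choice for all $n$). Define $h(l_1)=-\alpha$, $h(l_{-1})=-\beta$, $h(l_0)=-\gamma$ and $h(l_n)=1$ for $n\notin\{-1,0,1\}$. Let $W=\bigwedge^3V$, $\Delta=v_0\wedge v_1\wedge\cdots\wedge v_6\in\bigwedge^7V$, and for each line $l$ with cyclic order $(u_1,u_2,u_3)$ put $w_l=h(l)\,u_1\wedge u_2\wedge u_3\in W$. For each $j$ define the linear functional $\eta_{v_j}:W\to F$ by $v_j\wedge\big(\sum_{n}w_{l_n}\big)\wedge w=\eta_{v_j}(w)\Delta$. Let $$\mathfrak{B}=\{B\subseteq V \text{ 3-dimensional}: \eta_{v_j}(b_1\wedge b_2\wedge b_3)=0 \text{ for all } j, \text{ where } b_1,b_2,b_3 \text{ is a basis of } B\}.$$ Then $\mathfrak{B}$ is an inclusion-minimal $(7,3,2)$ $q$-covering design on $V$. Moreover, if the equation $$\lambda_0^2-\lambda_1^2\alpha-\lambda_2^2\beta-\lambda_3^2\gamma+\lambda_4^2\alpha\beta+\lambda_5^2\beta\gamma+\lambda_6^2\gamma\alpha-\lambda_7^2\alpha\beta\gamma=0$$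 has only the solution $\lambda_0=\dots=\lambda_7=0$ in $F$ (equivalently, the Cayley algebra $D_\gamma(D_\beta(D_\alpha(F)))$ is a division algebra), then $\mathfrak{B}$ is a $2$-$(7,3,1)$ subspace design ($q$-Fano plane) on $V$. (In particular, with $\alpha=\beta=\gamma=-1$ and $F\subseteq\mathbb{R}$, $\mathfrak{B}$ is a $q$-Fano plane.)
   Context: The condition $\eta_{v_j}(b_1\wedge b_2\wedge b_3)=0$ does not depend on the choice of basis of $B$. A $(v,k,t)$ $q$-covering design on a $v$-dimensional space is a set of $k$-dimensional subspaces such that every $t$-dimensional subspace lies in at least one of them; it is inclusion-minimal if no proper subset has this property. A $2$-$(7,3,1)$ subspace design: every 2-dimensional subspace lies in exactly one block. Cayley–Dickson doubling: for an algebra $A$ with involution $*$ and $\gamma\in F^\times$, $D_\gamma(A)=A\oplus A$ (elements $a+ib$) with $(a+ib)(c+id)=(ac+\gamma db^* )+i(a^*d+cb)$ and $(a+ib)^*=a^*-ib$, starting from $F$ with identity involution. *)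

(* Defs.v *)
From HB Require Import structures.
From mathcomp Require Import all_boot all_order all_algebra.
Set Implicit Arguments. Unset Strict Implicit. Unset Printing Implicit Defensive.
Import GRing.Theory.
Local Open Scope ring_scope.

Definition e (F : fieldType) (i : 'I_7) : 'rV[F]_7 := delta_mx 0 i.

Definition addI7 (n : 'I_7) (k : nat) : 'I_7 := inord ((n + k) %% 7).

Definition rows7 (F : fieldType) (s : seq 'rV[F]_7) : 'M[F]_7 :=
  \matrix_(i < 7, k < 7) (nth 0 s i) 0 k.

(* For 7 vectors x_1..x_7, x_1 /\ ... /\ x_7 = det(rows) * Delta, with
   Delta = v_0 /\ ... /\ v_6; this is the coefficient of a 7-form wrt Delta. *)
Definition wedge7 (F : fieldType) (s : seq 'rV[F]_7) : F := \det (rows7 s).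

Definition hw (F : fieldType) (a b c : F) (n : 'I_7) : F :=
  if val n == 1%N then - a
  else if val n == 6%N then - b
  else if val n == 0%N then - c
  else 1.

Definition line_pts (F : fieldType) (eps : bool) (n : 'I_7) : seq 'rV[F]_7 :=
  if eps then [:: e F (addI7 n 1); e F n; e F (addI7 n 3)]
  else [:: e F n; e F (addI7 n 1); e F (addI7 n 3)].

(* eta_{v_j}(b1 /\ b2 /\ b3): v_j /\ (sum_n w_{l_n}) /\ (b1/\b2/\b3) = eta * Delta,
   expanded by multilinearity of the wedge product. *)
Definition eta (F : fieldType) (a b c : F) (eps : bool) (j : 'I_7)
  (b1 b2 b3 : 'rV[F]_7) : F :=
  \sum_(n < 7) hw a b c n * wedge7 (e F j :: line_pts F eps n ++ [:: b1; b2; b3]).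

Definition frakB (F : fieldType) (a b c : F) (eps : bool)
  (B : {vspace 'rV[F]_7}) : Prop :=
  \dim B = 3%N /\
  forall bs : 3.-tuple 'rV[F]_7, basis_of B bs ->
    forall j : 'I_7, eta a b c eps j (tnth bs 0) (tnth bs 1) (tnth bs 2) = 0.

Definition q_covering (F : fieldType) (k t : nat)
  (S : {vspace 'rV[F]_7} -> Prop) : Prop :=
  (forall B, S B -> \dim B = k) /\
  (forall T : {vspace 'rV[F]_7}, \dim T = t -> exists B, S B /\ (T <= B)%VS).

Definition minimal_q_covering (F : fieldType) (k t : nat)
  (S : {vspace 'rV[F]_7} -> Prop) : Prop :=
  q_covering k t S /\
  (forall S' : {vspace 'rV[F]_7} -> Prop,
      (forall B, S' B -> S B) -> q_covering k t S' -> forall B, S B -> S' B).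

Definition subspace_design_2_7_3_1 (F : fieldType)
  (S : {vspace 'rV[F]_7} -> Prop) : Prop :=
  (forall B, S B -> \dim B = 3%N) /\
  (forall T : {vspace 'rV[F]_7}, \dim T = 2%N ->
     exists B, (S B /\ (T <= B)%VS) /\ forall B', S B' -> (T <= B')%VS -> B' = B).

Definition octonion_form (F : fieldType) (a b c : F) (l : 'I_8 -> F) : F :=
  l 0 ^+ 2 - l 1 ^+ 2 * a - l 2 ^+ 2 * b - l 3 ^+ 2 * c
  + l 4 ^+ 2 * (a * b) + l 5 ^+ 2 * (b * c) + l 6 ^+ 2 * (c * a)
  - l 7 ^+ 2 * (a * b * c).

(* Main.v *)
Require Import Defs.
From HB Require Import structures.
From mathcomp Require Import all_boot all_order all_algebra.
From mathcomp Require Import ring zify.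
Import GRing.Theory.
Local Open Scope ring_scope.
Set Implicit Arguments. Unset Strict Implicit. Unset Printing Implicit Defensive.

(** [V] is the space of imaginary elements of the Cayley algebra
    [D_c(D_b(D_a(F)))], and up to a common factor [eta_{v_j}(x /\ y /\ z)] is the
    pairing of [v_j] with the associator of [x], [y], [z]; it is thus an
    alternating 4-form [psi(x, y, z, v_j)], and a block is a 3-space on which the
    associator vanishes.

    Covering: [psi(x, y, -, -)] is an alternating form on a space of odd dimension
    whose radical contains [x] and [y].  Its rank is even, so its radical has
    dimension at least 3.

    Uniqueness: the 4x4 Pfaffians of [psi(x, y, -, -)] are, up to sign, the
    complementary 3x3 minors of [x], [y], [x * y], where [*] is the cross product
    (the imaginary part of the product).  So as soon as [x * y] is not in
    [<x, y>], the radical is exactly 3-dimensional and [<x, y>] lies in only one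
    block.  If the norm is anisotropic this holds for all independent [x], [y].

    Minimality: every block contains such a pair [x], [y].  Otherwise
    [x * y = f(x) y - f(y) x] on the block for a linear form [f]; then the
    symmetric part of the tensor [x ⊗ (y * z) + y ⊗ (z * x) + z ⊗ (x * y)]
    and the scalar [<x * y, z>] vanish, as well as [psi(x, y, z, -)].  These three
    determine the trivector [x /\ y /\ z], which would be zero. *)

(** * Skew-symmetric matrices and small determinants *)

Section LinearAlgebra.
Variable F : fieldType.

(** Let [f] select a maximal set of independent rows. By skew symmetry the columns in [f] have the
    same rank, and they factor through the principal submatrix [P], so [P] is invertible. A skew
    matrix of odd size has determinant equal to its own negative. *)
Lemma skew_rank_even n (A : 'M[F]_n) :
  2%:R != 0 :> F -> A^T = - A -> ~~ odd (\rank A).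
Proof.
move=> nz2 skewA; apply/negP => odd_r.
have skewE i j : A i j = - A j i by rewrite -[A in LHS]trmxK skewA !mxE.
set f := maxrankfun A; set P := mxsub f f A.
have defA : A = A *m pinvmx (rowsub f A) *m rowsub f A.
  by rewrite mulmxKpV // eq_maxrowsub.
have uP : P \in unitmx.
  rewrite -row_free_unit -row_leq_rank -{1}(eqP (maxrowsub_free A)).
  have -> : \rank (rowsub f A) = \rank (colsub f A).
    have -> : colsub f A = - (rowsub f A)^T.
      by apply/matrixP => i j; rewrite !mxE skewE.
    by rewrite mxrank_opp mxrank_tr.
  have -> : colsub f A = A *m pinvmx (rowsub f A) *m P.
    by rewrite /P (mxsubcr f f) mulmx_colsub -defA.
  exact: mxrankM_maxr.
have : \det P = - \det P.
  rewrite -[in LHS]det_tr (_ : P^T = -1 *: P).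
    by rewrite detZ -signr_odd odd_r expr1 mulN1r.
  by rewrite trmx_mxsub skewA scaleN1r; apply/matrixP => i j; rewrite !mxE.
move/eqP; rewrite -addr_eq0 -mulr2n -mulr_natl mulf_eq0 (negbTE nz2) /=.
by rewrite -[_ == 0]negbK -unitfE -unitmxE uP.
Qed.

Lemma mxrank_mxsub m n m' n' (f : 'I_m' -> 'I_m) (g : 'I_n' -> 'I_n) (A : 'M[F]_(m, n)) :
  (\rank (mxsub f g A) <= \rank A)%N.
Proof.
rewrite mxsubrc; apply: leq_trans (mxrankS (rowsub_sub _ _)) _.
by rewrite -mxrank_tr trmx_mxsub -(mxrank_tr A) mxrankS ?rowsub_sub.
Qed.

Lemma row_free_of_free m n (X : m.-tuple 'rV[F]_n) :
  free X -> row_free (\matrix_(i < m) tnth X i).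
Proof.
move/freeP => freeX; apply: inj_row_free => v.
rewrite mulmx_sum_row => v0; apply/rowP => i; rewrite mxE.
apply: (freeX (fun i => v 0 i)); rewrite -[RHS]v0; apply: eq_bigr => j _.
by rewrite rowK (tnth_nth 0).
Qed.

Lemma det_mx33 (A : 'M[F]_3) :
  \det A = A 0 0 * (A 1 1 * A 2 2 - A 1 2 * A 2 1)
         - A 0 1 * (A 1 0 * A 2 2 - A 1 2 * A 2 0)
         + A 0 2 * (A 1 0 * A 2 1 - A 1 1 * A 2 0).
Proof.
pose B i j := A (inord i) (inord j).
have AB i j : A i j = B i j by rewrite /B !inord_val.
rewrite (expand_det_row _ 0) !big_ord_recl big_ord0 /cofactor !(expand_det_row _ 0).
rewrite !big_ord_recl !big_ord0 /cofactor !det_mx11 !mxE !AB /= /bump /=.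
ring.
Qed.

(** The expression squared is the Pfaffian. *)
Lemma det_skew4 (A : 'M[F]_4) : A^T = - A -> (forall i, A i i = 0) ->
  \det A = (A 0 1 * A 2 3 - A 0 2 * A 1 3 + A 0 3 * A 1 2) ^+ 2.
Proof.
move=> skewA diagA; pose B i j := A (inord i) (inord j).
have AB i j : A i j = B i j by rewrite /B !inord_val.
have skewB i j : B i j = - B j i by rewrite /B -[A in LHS]trmxK skewA !mxE.
have diagB i : B i i = 0 by apply: diagA.
rewrite (expand_det_row _ 0) !big_ord_recl big_ord0 /cofactor !det_mx33 !mxE !AB /= /bump /=.
rewrite !diagB (skewB 1 0)%N (skewB 2 0)%N (skewB 3 0)%N (skewB 2 1)%N (skewB 3 1)%N (skewB 3 2)%N.
ring.
Qed.

(** * Spans and independence of two or three vectors *)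

Section Span.
Variable vT : vectType F.
Implicit Types x y z v : vT.

Lemma mem_span2P x y v :
  reflect (exists p q, v = p *: x + q *: y) (v \in <<[:: x; y]>>%VS).
Proof.
rewrite span_cons span_seq1; apply: (iffP memv_addP).
  by case=> _ /vlineP[p ->] [_ /vlineP[q ->] ->]; exists p, q.
case=> p [q ->]; exists (p *: x); first by rewrite memvZ ?memv_line.
by exists (q *: y) => //; rewrite memvZ ?memv_line.
Qed.

Lemma mem_span3P x y z v :
  reflect (exists p q r, v = p *: x + q *: y + r *: z) (v \in <<[:: x; y; z]>>%VS).
Proof.
rewrite span_cons; apply: (iffP memv_addP).
  case=> _ /vlineP[p ->] [_ /mem_span2P[q [r ->]] ->].
  by exists p, q, r; rewrite addrA.
case=> p [q [r ->]]; exists (p *: x); first by rewrite memvZ ?memv_line.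
exists (q *: y + r *: z); last by rewrite addrA.
by apply/mem_span2P; exists q, r.
Qed.

Lemma free2P x y :
  free [:: x; y] <-> forall p q, p *: x + q *: y = 0 -> p = 0 /\ q = 0.
Proof.
split=> [/(@freeP _ _ _ [tuple x; y]) freeX p q sum0 | ind].
  have k0 := freeX (fun i : 'I_2 => nth 0 [:: p; q] i).
  rewrite !big_ord_recl big_ord0 addr0 in k0.
  by move/(_ sum0): k0 => k0; split; [exact: (k0 0) | exact: (k0 1)].
apply/(@freeP _ _ _ [tuple x; y]) => k.
rewrite !big_ord_recl big_ord0 addr0 /= => /ind[k0 k1] i.
case: i => [[|[|//]] lti]; first by rewrite -k0; congr k; apply: val_inj.
by rewrite -k1; congr k; apply: val_inj.
Qed.

Lemma free3_eq0 x y z p q r : free [:: x; y; z] ->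
  p *: x + q *: y + r *: z = 0 -> [/\ p = 0, q = 0 & r = 0].
Proof.
move=> /(@freeP _ _ _ [tuple x; y; z]) freeX sum0.
have k0 := freeX (fun i : 'I_3 => nth 0 [:: p; q; r] i).
rewrite !big_ord_recl big_ord0 addr0 addrA in k0.
by move/(_ sum0): k0 => k0; split; [exact: (k0 0) | exact: (k0 1) | exact: (k0 2)].
Qed.

(** These are the six pairs on which [exists_free_cross] tests the cross product. *)
Lemma free3_pairs x y z : free [:: x; y; z] ->
  [/\ free [:: x; y], free [:: x; z] & free [:: y; z]] /\
  [/\ free [:: x; y + z], free [:: y; x + z] & free [:: z; x + y]].
Proof.
move=> fr; have ind p q r v : v = 0 -> v = p *: x + q *: y + r *: z -> [/\ p = 0, q = 0 & r = 0].
  by move=> -> eq0; apply: (free3_eq0 fr).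
split; split; apply/free2P => p q eq0.
- by have [|-> -> _] := ind p q 0 _ eq0; rewrite ?scale0r ?addr0.
- by have [|-> _ ->] := ind p 0 q _ eq0; rewrite ?scale0r ?addr0.
- by have [|_ -> ->] := ind 0 p q _ eq0; rewrite ?scale0r ?add0r.
- by have [|-> -> _] := ind p q q _ eq0; rewrite ?scalerDr ?addrA.
- by have [|-> -> _] := ind q p q _ eq0; rewrite // scalerDr addrCA addrA.
- by have [|-> _ ->] := ind q q p _ eq0; rewrite // scalerDr addrC.
Qed.

Lemma dim3_basis (B : {vspace vT}) : \dim B = 3%N -> exists x y z, basis_of B [:: x; y; z].
Proof.
move=> dimB; have := vbasisP B; move: (vbasis B); rewrite dimB.
by case=> [[|x [|y [|z []]]]] //= _ bB; exists x, y, z.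
Qed.

Lemma dim2_basis (T : {vspace vT}) : \dim T = 2%N -> exists x y, basis_of T [:: x; y].
Proof.
move=> dimT; have := vbasisP T; move: (vbasis T); rewrite dimT.
by case=> [[|x [|y []]]] //= _ bT; exists x, y.
Qed.

End Span.
End LinearAlgebra.

(** * Wedge products with basis vectors as signed minors *)

Section Minors.
Variable F : fieldType.

(** With rows indexed by [nat] and columns kept in a list, deleting a row is a shift of [R] and
    deleting a column is [rem], so iterated expansions compute. *)
Definition mxcols n (R : nat -> nat -> F) (cs : seq nat) : 'M[F]_n :=
  \matrix_(i < n, j < n) R i (nth 0%N cs j).

Lemma det_mxcols_delta n (R : nat -> nat -> F) (cs : seq nat) (p : nat) :
  uniq cs -> size cs = n.+1 -> {in cs, forall k, R 0%N k = (k == p)%:R} ->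
  \det (mxcols n.+1 R cs) =
  if p \in cs then (-1) ^+ index p cs * \det (mxcols n (fun i => R i.+1) (rem p cs))
  else 0.
Proof.
move=> ucs scs R0; rewrite (expand_det_row _ ord0).
have nE (j : 'I_n.+1) : R 0%N (nth 0%N cs j) = (nth 0%N cs j == p)%:R.
  by apply/R0/mem_nth; rewrite scs.
case: ifPn => [pcs | pNcs]; last first.
  apply: big1 => j _; rewrite mxE nE (_ : _ == p = false) ?mul0r //.
  by apply/negbTE; apply: contraNneq pNcs => <-; apply: mem_nth; rewrite scs.
have lt_i : (index p cs < n.+1)%N by rewrite -scs index_mem.
rewrite (bigD1 (Ordinal lt_i)) //= big1 ?addr0 => [|j ne_j]; last first.
  rewrite mxE nE (_ : _ == p = false) ?mul0r //; apply: contraNF ne_j => /eqP def_p.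
  by rewrite -val_eqE /= -def_p index_uniq ?scs.
rewrite mxE nE nth_index // eqxx mul1r /cofactor add0n; congr (_ * \det _).
apply/matrixP => i j; rewrite !mxE remE /= nth_cat size_take scs lt_i /bump.
case: ltnP => hj; first by rewrite nth_take.
by rewrite nth_drop addSn subnKC.
Qed.

(* Laplace expansion of a determinant with columns [cs] along rows
   [e_p], [p] in [ps]: [Some (s, r)] if it leaves the columns [r] with sign
   [(-1) ^+ s], and [None] if the determinant is zero. *)
Fixpoint cofactors (ps cs : seq nat) : option (bool * seq nat) :=
  if ps is p :: ps' then
    if p \in cs then
      if cofactors ps' (rem p cs) is Some (s, r) then Some (odd (index p cs) (+) s, r)
      else None
    else None
  else Some (false, cs).

Lemma det_mxcols_deltas n (ps : seq nat) (R : nat -> nat -> F) (cs : seq nat) :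
  uniq cs -> size cs = (size ps + n)%N ->
  (forall i, (i < size ps)%N -> {in cs, forall k, R i k = (k == nth 0%N ps i)%:R}) ->
  \det (mxcols (size ps + n) R cs) =
  if cofactors ps cs is Some (s, r) then
    (-1) ^+ s * \det (mxcols n (fun i => R (size ps + i)%N) r)
  else 0.
Proof.
elim: ps R cs => [|p ps IHps] R cs ucs scs Rps /=; first by rewrite expr0 mul1r.
rewrite (@det_mxcols_delta _ _ _ p) //; last exact: (Rps 0%N).
case: ifP => // pcs; rewrite IHps ?rem_uniq ?size_rem ?scs //; last first.
  by move=> i lt_i k /mem_rem; apply: (Rps i.+1).
case: (cofactors ps _) => [[s r]|]; rewrite ?mulr0 // mulrA; congr (_ * _).
by rewrite signr_addb signr_odd.
Qed.

Lemma size_cofactors n (ps cs : seq nat) s r :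
  uniq cs -> size cs = (size ps + n)%N -> cofactors ps cs = Some (s, r) -> size r = n.
Proof.
elim: ps cs s => [|p ps IHps] cs s ucs scs /=; first by case=> _ <-.
case: ifP => // pcs; case E: (cofactors _ _) => [[s' r']|] // [_ def_r].
by move: E; rewrite def_r; apply: IHps; rewrite ?rem_uniq ?size_rem ?scs.
Qed.

Definition coord (x : 'rV[F]_7) (i : nat) : F := x 0 (inord i).

Definition minor2 (x y : 'rV[F]_7) (i j : nat) : F :=
  coord x i * coord y j - coord x j * coord y i.

Definition minor3 (x y z : 'rV[F]_7) (i j k : nat) : F :=
  coord x i * minor2 y z j k - coord x j * minor2 y z i k + coord x k * minor2 y z i j.

Lemma wedge7E (ps : seq 'I_7) (x y z : 'rV[F]_7) : size ps = 4%N ->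
  wedge7 (map (e F) ps ++ [:: x; y; z]) =
  if cofactors (map val ps) (iota 0 7) is Some (s, [:: i; j; k]) then
    (-1) ^+ s * minor3 x y z i j k
  else 0.
Proof.
move=> sps; set vs := map (e F) ps ++ _.
have szp : size (map val ps) = 4%N by rewrite size_map.
rewrite /wedge7 (_ : rows7 vs = mxcols 7 (fun i k => coord (nth 0 vs i) k) (iota 0 7)).
  have := @det_mxcols_deltas 3 (map val ps) (fun i k => coord (nth 0 vs i) k) (iota 0 7).
  rewrite szp => -> //; last first.
    move=> i lt_i k; rewrite mem_iota /= add0n => lt_k.
    rewrite /coord nth_cat size_map sps lt_i (nth_map 0) ?sps // mxE eqxx /=.
    by rewrite -val_eqE /= inordK // (nth_map 0) ?sps.
  case E : (cofactors _ _) => [[s r]|] //.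
  have sr : size r = 3%N by apply: (size_cofactors _ _ E); rewrite ?szp.
  case: r sr {E} => [|i [|j [|k []]]] // _; congr (_ * _).
  by rewrite det_mx33 !mxE /= /vs !nth_cat !size_map sps.
apply/matrixP => i k; rewrite !mxE (nth_iota _ _ (ltn_ord k)) add0n.
by rewrite /coord inord_val.
Qed.

Lemma coordE (x : 'rV[F]_7) (k : 'I_7) : x 0 k = coord x k.
Proof. by rewrite /coord inord_val. Qed.

Lemma coordD x y i : coord (x + y) i = coord x i + coord y i.
Proof. by rewrite /coord mxE. Qed.

Lemma coordZ p x i : coord (p *: x) i = p * coord x i.
Proof. by rewrite /coord mxE. Qed.

Lemma coord_e (j : 'I_7) i : (i < 7)%N -> coord (e F j) i = (i == j)%:R.
Proof. by move=> lt_i; rewrite /coord mxE eqxx -val_eqE /= inordK. Qed.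

Lemma minor3_e x y (m : 'I_7) i j k : (i < 7)%N -> (j < 7)%N -> (k < 7)%N ->
  minor3 x y (e F m) i j k =
  (i == m)%:R * minor2 x y j k - (j == m)%:R * minor2 x y i k + (k == m)%:R * minor2 x y i j.
Proof. by move=> *; rewrite /minor3 /minor2 !coord_e //; ring. Qed.

Lemma minor3_sorted x y z : (forall i j k : 'I_7, (i < j < k)%N -> minor3 x y z i j k = 0) ->
  forall i j k : 'I_7, minor3 x y z i j k = 0.
Proof.
move=> m0 i j k.
have swap12 p q r : minor3 x y z p q r = - minor3 x y z q p r.
  by rewrite /minor3 /minor2; ring.
have swap23 p q r : minor3 x y z p q r = - minor3 x y z p r q.
  by rewrite /minor3 /minor2; ring.
have dup12 p q : minor3 x y z p p q = 0 by rewrite /minor3 /minor2; ring.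
have dup23 p q : minor3 x y z p q q = 0 by rewrite /minor3 /minor2; ring.
have dup13 p q : minor3 x y z p q p = 0 by rewrite swap12 dup23 oppr0.
case: (ltngtP i j) => [ij|ji|->]; last exact: dup12;
case: (ltngtP j k) => [jk|kj|->]; try exact: dup23;
case: (ltngtP i k) => [ik|ki|->]; try exact: dup13; try lia.
- by rewrite m0 ?ij.
- by rewrite swap23 m0 ?ik ?kj ?oppr0.
- by rewrite swap23 swap12 m0 ?ki ?ij ?oppr0.
- by rewrite swap12 m0 ?ji ?ik ?oppr0.
- by rewrite swap12 swap23 m0 ?jk ?ki ?oppr0.
- by rewrite swap12 swap23 swap12 m0 ?kj ?ji ?oppr0.
Qed.

(** A matrix of rank 3 has three independent columns, given by [fullrankfun]; they need not be
    increasing, whence [minor3_sorted]. *)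
Lemma minor3_neq0 x y z : free [:: x; y; z] ->
  ~ (forall i j k : 'I_7, (i < j < k)%N -> minor3 x y z i j k = 0).
Proof.
move=> /(@row_free_of_free _ _ _ [tuple x; y; z]); set A := \matrix_(i < 3) _.
rewrite -row_leq_rank -mxrank_tr => rkA /minor3_sorted m0.
have fA : row_full A^T by rewrite /row_full eqn_leq rank_leq_col.
have := fullrowsub_unit fA; rewrite unitmxE unitfE det_mx33 !mxE => /negP; apply.
rewrite (_ : tnth _ 0 = x) // (_ : tnth _ 1 = y) // (_ : tnth _ 2 = z) // !coordE.
rewrite -[X in _ == X](m0 (fullrankfun fA 0) (fullrankfun fA 1) (fullrankfun fA 2)).
by apply/eqP; rewrite /minor3 /minor2; ring.
Qed.

(** * The 4-form, the cross product and their polynomial identities *)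

Section Fano.
Variables a b c : F.
Implicit Types x y z u v w : 'rV[F]_7.

(** The minor on columns [i], [k], [m] occurs in component [j] when the complement of these four
    indices is a Fano line; its coefficient is, up to sign, the weight [hw] of that line. The last
    branch stands for [j = 6]. *)
Definition psi (x y z : 'rV[F]_7) (j : nat) : F :=
  match j with
  | 0%N => a * minor3 x y z 3 5 6 + minor3 x y z 1 4 6 - minor3 x y z 1 2 5 + minor3 x y z 2 3 4
  | 1%N => - minor3 x y z 0 4 6 + minor3 x y z 0 2 5 - minor3 x y z 2 3 6 - b * minor3 x y z 3 4 5
  | 2%N => - (c * minor3 x y z 4 5 6) - minor3 x y z 0 1 5 + minor3 x y z 1 3 6 - minor3 x y z 0 3 4
  | 3%N => - (a * minor3 x y z 0 5 6) - minor3 x y z 1 2 6 + minor3 x y z 0 2 4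
           + b * minor3 x y z 1 4 5
  | 4%N => c * minor3 x y z 2 5 6 + minor3 x y z 0 1 6 - minor3 x y z 0 2 3 - b * minor3 x y z 1 3 5
  | 5%N => - (c * minor3 x y z 2 4 6) + a * minor3 x y z 0 3 6 + minor3 x y z 0 1 2
           + b * minor3 x y z 1 3 4
  | _ => c * minor3 x y z 2 4 5 - a * minor3 x y z 0 3 5 - minor3 x y z 0 1 4 + minor3 x y z 1 2 3
  end.

(* [v_0, v_1, v_2, v_3, v_4, v_6, v_5] play the roles of [i, j, k, ij, jk, ki]
   and of a product of [i, j, k]; their norms are the coefficients of [bil] below.
   In [<x * y, z>] the minor on the line [l_n] has coefficient [- a b c / h(l_n)]. *)
Definition cross_coord (x y : 'rV[F]_7) (k : nat) : F :=
  match k with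
  | 0%N => - (b * minor2 x y 1 3) + b * c * minor2 x y 4 5 - c * minor2 x y 2 6
  | 1%N => - (a * minor2 x y 3 0) - c * minor2 x y 2 4 + a * c * minor2 x y 5 6
  | 2%N => - (b * minor2 x y 4 1) + a * b * minor2 x y 3 5 - a * minor2 x y 6 0
  | 3%N => minor2 x y 0 1 - c * minor2 x y 5 2 - c * minor2 x y 4 6
  | 4%N => minor2 x y 1 2 - a * minor2 x y 6 3 - a * minor2 x y 5 0
  | 5%N => minor2 x y 2 3 + minor2 x y 0 4 + minor2 x y 6 1
  | _ => - (b * minor2 x y 3 4) - b * minor2 x y 1 5 + minor2 x y 0 2
  end.

Definition cross x y : 'rV[F]_7 := \row_(k < 7) cross_coord x y k.

Definition bil x y : F :=
  - (a * coord x 0 * coord y 0) - b * coord x 1 * coord y 1 - c * coord x 2 * coord y 2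
  + a * b * coord x 3 * coord y 3 + b * c * coord x 4 * coord y 4
  - a * b * c * coord x 5 * coord y 5 + c * a * coord x 6 * coord y 6.

Definition phi x y z := bil (cross x y) z.

Lemma coord_cross x y i : (i < 7)%N -> coord (cross x y) i = cross_coord x y i.
Proof. by move=> lt_i; rewrite /coord mxE inordK. Qed.

(** Reversing the cyclic order of every line only negates the form, so both values of [eps] give the
    same blocks. *)
Lemma etaE eps (j : 'I_7) x y z : Defs.eta a b c eps j x y z = (-1) ^+ eps * psi x y z j.
Proof.
transitivity (\sum_(n < 7) hw a b c n * wedge7 (map (e F) (j ::
    if eps then [:: addI7 n 1; n; addI7 n 3] else [:: n; addI7 n 1; addI7 n 3])
    ++ [:: x; y; z])).
  by apply: eq_bigr => n _; case: eps.
under eq_bigr => n _ do (rewrite wedge7E; last by case: (eps)).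
rewrite !big_ord_recl big_ord0 /= /hw /addI7 /=.
case: eps; rewrite /= !inordK //.
  by case: j => [[|[|[|[|[|[|[|//]]]]]]] lt_j]; rewrite /= ?expr0 ?expr1; ring.
by case: j => [[|[|[|[|[|[|[|//]]]]]]] lt_j]; rewrite /= ?expr0 ?expr1; ring.
Qed.

Lemma bilC x y : bil x y = bil y x.
Proof. rewrite /bil; ring. Qed.

Lemma bilDl x y z : bil (x + y) z = bil x z + bil y z.
Proof. rewrite /bil !coordD; ring. Qed.

Lemma bilZl p x y : bil (p *: x) y = p * bil x y.
Proof. rewrite /bil !coordZ; ring. Qed.

Lemma bilDr x y z : bil x (y + z) = bil x y + bil x z.
Proof. by rewrite bilC bilDl !(bilC x). Qed.

Lemma bilZr p x y : bil x (p *: y) = p * bil x y.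
Proof. by rewrite bilC bilZl (bilC x). Qed.

Lemma crossDr x y z : cross x (y + z) = cross x y + cross x z.
Proof.
apply/rowP => k; rewrite !mxE /cross_coord /minor2.
by case: (val k) => [|[|[|[|[|[|?]]]]]]; rewrite !coordD; ring.
Qed.

Lemma crossC x y : cross y x = - cross x y.
Proof.
apply/rowP => k; rewrite !mxE /cross_coord /minor2.
by case: (val k) => [|[|[|[|[|[|?]]]]]]; ring.
Qed.

Lemma phi_cyc x y z : phi y z x = phi x y z.
Proof. rewrite /phi /bil !coord_cross // /cross_coord /minor2; ring. Qed.

Lemma bil_crossl x y : bil (cross x y) x = 0.
Proof. rewrite /bil !coord_cross // /cross_coord /minor2; ring. Qed.

Lemma bil_crossr x y : bil (cross x y) y = 0.
Proof. rewrite /bil !coord_cross // /cross_coord /minor2; ring. Qed.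

(** This is multiplicativity of the norm: the product of two imaginary elements has imaginary part
    [cross x y] and real part [bil x y] up to sign. *)
Lemma bil_cross_cross x y :
  bil (cross x y) (cross x y) = bil x x * bil y y - bil x y ^+ 2.
Proof. rewrite /bil !coord_cross // /cross_coord /minor2; ring. Qed.

Definition cross_tensor x y z u v := bil u x * bil v (cross y z)
   + bil u y * bil v (cross z x) + bil u z * bil v (cross x y).

(* The weights are [(a b c)^2] divided by the norms of the [v_j]. *)
Definition psi_dot x y z u v w := a * b * c *
  (- (b * c * psi x y z 0 * psi u v w 0) - c * a * psi x y z 1 * psi u v w 1
   - a * b * psi x y z 2 * psi u v w 2 + c * psi x y z 3 * psi u v w 3
   + a * psi x y z 4 * psi u v w 4 - psi x y z 5 * psi u v w 5
   + b * psi x y z 6 * psi u v w 6).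

(* Away from characteristic 2 this makes
   [x /\ y /\ z |-> (symmetric part of cross_tensor, psi, phi)] injective. *)
Lemma gram3_decomposition x y z u v w :
  4%:R * (bil u x * (bil v y * bil w z - bil v z * bil w y)
   - bil u y * (bil v x * bil w z - bil v z * bil w x)
   + bil u z * (bil v x * bil w y - bil v y * bil w x))
  = cross_tensor x y z u (cross v w) + cross_tensor x y z (cross v w) u
  + cross_tensor x y z v (cross w u) + cross_tensor x y z (cross w u) v
  + cross_tensor x y z w (cross u v) + cross_tensor x y z (cross u v) w
  + psi_dot x y z u v w - 2%:R * phi x y z * phi u v w.
Proof.
rewrite /phi /cross_tensor /psi_dot /bil !coord_cross // /cross_coord /psi /minor3 /minor2; ring.
Qed.

Definition skewmx x y : 'M[F]_7 := \matrix_(i, j) psi x y (e F i) j.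

Definition pf4 (A : 'M[F]_7) (p q r s : nat) : F :=
  let M m n := A (inord m) (inord n) in
  M p q * M r s - M p r * M q s + M p s * M q r.

(** Here [cofactors] supplies the complement of the three indices together with the sign of the
    shuffle. The identity is polynomial and is checked for each of the 35 triples. *)
Lemma minor3_cross x y (i j k : 'I_7) s p q r t : (i < j < k)%N ->
  cofactors [:: val i; val j; val k] (iota 0 7) = Some (s, [:: p; q; r; t]) ->
  minor3 x y (cross x y) i j k = - (-1) ^+ s * pf4 (skewmx x y) p q r t.
Proof.
case: i j k => [[|[|[|[|[|[|[|//]]]]]]] ?] [[|[|[|[|[|[|[|//]]]]]]] ?]
  [[|[|[|[|[|[|[|//]]]]]]] ?] //= _ [] <- <- <- <- <-;
  rewrite /pf4 !mxE !inordK //= !minor3_e // !inordK //=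
          /minor3 /minor2 !coord_cross //= /minor2 ?expr0 ?expr1; ring.
Qed.

Lemma mul_skewmx x y z : z *m skewmx x y = \row_j psi x y z j.
Proof.
apply/rowP => j; rewrite !mxE !big_ord_recl big_ord0 !mxE !coordE /= /bump /=.
case: j => [[|[|[|[|[|[|[|//]]]]]]] ?];
  rewrite /= !minor3_e //= /bump /= /minor3 /minor2; ring.
Qed.

Lemma skewmx_anti x y i j : skewmx x y i j = - skewmx x y j i.
Proof.
rewrite !mxE; case: i j => [[|[|[|[|[|[|[|//]]]]]]] ?] [[|[|[|[|[|[|[|//]]]]]]] ?];
  rewrite /= !minor3_e //=; ring.
Qed.

Lemma skewmx_diag x y i : skewmx x y i i = 0.
Proof.
rewrite !mxE; case: i => [[|[|[|[|[|[|[|//]]]]]]] ?];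
  rewrite /= !minor3_e //=; ring.
Qed.

Lemma psi_comb x y z p1 q1 r1 p2 q2 r2 p3 q3 r3 j :
  psi (p1 *: x + q1 *: y + r1 *: z) (p2 *: x + q2 *: y + r2 *: z)
      (p3 *: x + q3 *: y + r3 *: z) j =
  (p1 * (q2 * r3 - q3 * r2) - q1 * (p2 * r3 - p3 * r2) + r1 * (p2 * q3 - p3 * q2))
  * psi x y z j.
Proof.
have mE i k l : minor3 (p1 *: x + q1 *: y + r1 *: z) (p2 *: x + q2 *: y + r2 *: z)
      (p3 *: x + q3 *: y + r3 *: z) i k l =
  (p1 * (q2 * r3 - q3 * r2) - q1 * (p2 * r3 - p3 * r2) + r1 * (p2 * q3 - p3 * q2))
  * minor3 x y z i k l.
  by rewrite /minor3 /minor2 !coordD !coordZ; ring.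
by case: j => [|[|[|[|[|[|j]]]]]]; rewrite /psi !mE; ring.
Qed.

(** * Blocks: covering, uniqueness and minimality *)

Hypotheses (nz2 : 2%:R != 0 :> F) (nza : a != 0) (nzb : b != 0) (nzc : c != 0).
Implicit Types B T : {vspace 'rV[F]_7}.

Lemma psi_span x y z : (forall j : 'I_7, psi x y z j = 0) ->
  forall u v w, u \in <<[:: x; y; z]>>%VS -> v \in <<[:: x; y; z]>>%VS ->
  w \in <<[:: x; y; z]>>%VS -> forall j : 'I_7, psi u v w j = 0.
Proof.
move=> psi0 u v w /mem_span3P[p1 [q1 [r1 ->]]] /mem_span3P[p2 [q2 [r2 ->]]].
by move=> /mem_span3P[p3 [q3 [r3 ->]]] j; rewrite psi_comb psi0 mulr0.
Qed.

Lemma frakBP eps B : frakB a b c eps B <-> \dim B = 3%N /\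
  forall x y z, x \in B -> y \in B -> z \in B -> forall j : 'I_7, psi x y z j = 0.
Proof.
split=> [[dimB eta0]|[dimB psi0]]; split=> //; last first.
  move=> bs /basis_mem bsB j; rewrite etaE psi0 ?mulr0 //; apply/bsB/mem_tnth.
have [x [y [z bB]]] := dim3_basis dimB.
move=> u v w; rewrite -(span_basis bB); apply: psi_span => j.
have /eqP := eta0 [tuple x; y; z] bB j.
by rewrite etaE mulf_eq0 signr_eq0 => /eqP.
Qed.

Lemma psi_xyx x y j : psi x y x j = 0.
Proof. by case: j => [|[|[|[|[|[|j]]]]]]; rewrite /psi /minor3 /minor2; ring. Qed.

Lemma psi_xyy x y j : psi x y y j = 0.
Proof. by case: j => [|[|[|[|[|[|j]]]]]]; rewrite /psi /minor3 /minor2; ring. Qed.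

Lemma trmx_skewmx x y : (skewmx x y)^T = - skewmx x y.
Proof. by apply/matrixP => i j; rewrite mxE skewmx_anti [RHS]mxE. Qed.

Lemma exists_psi_eq0 x y : free [:: x; y] ->
  exists2 z, free [:: z; x; y] & forall j : 'I_7, psi x y z j = 0.
Proof.
move=> fxy; set M := skewmx x y; pose A : 'M[F]_(2, 7) := \matrix_(i < 2) tnth [tuple x; y] i.
have rkA : \rank A = 2%N.
  by apply/eqP; rewrite eqn_leq rank_leq_row row_leq_rank; apply: row_free_of_free.
have AM : A *m M = 0.
  apply/row_matrixP => i; rewrite row_mul rowK row0 mul_skewmx.
  apply/rowP => j; rewrite !mxE.
  by case: i => [[|[|//]] ?]; rewrite (tnth_nth 0) /= ?psi_xyx ?psi_xyy.
(* [A *m M = 0] bounds the rank by 7 - 2 = 5, and 5 is odd. *)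
have rkM : (\rank M <= 4)%N.
  have := mulmx0_rank_max AM; have := skew_rank_even nz2 (trmx_skewmx x y).
  by rewrite rkA -/M; case: (\rank M) => [|[|[|[|[|[|n]]]]]].
(* The kernel has dimension at least 3, so it is not contained in the span of [x] and [y]. *)
have /row_subPn[i Ni] : ~~ (kermx M <= A)%MS.
  by apply: contraL rkM => /mxrankS; rewrite mxrank_ker rkA; case: (\rank M) => [|[|[|[|[|n]]]]].
exists (row i (kermx M)) => [|j].
  rewrite free_cons fxy andbT; apply: contra Ni => /mem_span2P[p [q ->]].
  apply: addmx_sub; apply: scalemx_sub.
    by rewrite (_ : x = row 0 A) ?row_sub // rowK.
  by rewrite (_ : y = row 1 A) ?row_sub // rowK.
have /rowP/(_ j) : row i (kermx M) *m M = 0 by rewrite -row_mul mulmx_ker row0.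
by rewrite mul_skewmx !mxE.
Qed.

Lemma frakB_covering eps : q_covering 3 2 (frakB a b c eps).
Proof.
split=> [B [] //|T dimT].
have [x [y bT]] := dim2_basis dimT; have fxy := basis_free bT.
have [z fzxy psi0] := exists_psi_eq0 fxy.
exists <<[:: x; y; z]>>%VS; split; last first.
  rewrite -(span_basis bT); apply/span_subvP => v; rewrite !inE => /orP[]/eqP->;
  by apply: memv_span; rewrite !inE eqxx ?orbT.
apply/frakBP; split; last exact: psi_span.
have : free [:: x; y; z] by rewrite (perm_free (permEl (perm_rcons z [:: x; y]))).
by move/eqP.
Qed.

(** If the rank were at most 3, all principal 4x4 minors would vanish, hence their square roots, the
    Pfaffians, and by [minor3_cross] every 3x3 minor of [x], [y], [cross x y]. *)
Lemma skewmx_rank x y : free [:: cross x y; x; y] -> (3 < \rank (skewmx x y))%N.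
Proof.
move=> fr; rewrite ltnNge; apply/negP => rkM.
have {}fr : free [:: x; y; cross x y].
  by rewrite (perm_free (permEl (perm_rcons (cross x y) [:: x; y]))).
apply: (minor3_neq0 fr) => i j k lt_ijk.
case E: (cofactors [:: val i; val j; val k] (iota 0 7)) => [[s r]|]; last first.
  move: i j k lt_ijk E => [[|[|[|[|[|[|[|//]]]]]]] ?] [[|[|[|[|[|[|[|//]]]]]]] ?];
  by move=> [[|[|[|[|[|[|[|//]]]]]]] ?].
have sr : size r = 4%N by apply: size_cofactors E.
case: r sr E => [|p [|q [|r [|t []]]]] // _ E; rewrite (minor3_cross _ _ lt_ijk E).
pose f (m : 'I_4) : 'I_7 := inord (nth 0%N [:: p; q; r; t] m).
have : \det (mxsub f f (skewmx x y)) = 0.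
  apply/eqP; rewrite -[_ == 0]negbK -unitfE -unitmxE -row_free_unit -row_leq_rank.
  by rewrite -ltnNge ltnS; apply: leq_trans (mxrank_mxsub _ _ _) rkM.
have skewf : (mxsub f f (skewmx x y))^T = - mxsub f f (skewmx x y).
  by rewrite trmx_mxsub trmx_skewmx; apply/matrixP => m n; rewrite !mxE.
rewrite (det_skew4 skewf) => [/eqP|m]; last by rewrite mxE skewmx_diag.
rewrite sqrf_eq0 !mxE => /eqP pf0; rewrite [pf4 _ _ _ _ _](_ : _ = 0) ?mulr0 //.
by rewrite /pf4 !mxE.
Qed.

Lemma frakB_unique eps x y B B' : free [:: cross x y; x; y] ->
  frakB a b c eps B -> frakB a b c eps B' ->
  x \in B -> y \in B -> x \in B' -> y \in B' -> B' = B.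
Proof.
move=> fr /frakBP[dimB psiB] /frakBP[dimB' psiB'] xB yB xB' yB'.
apply/eqP; rewrite eqEdim dimB dimB' leqnn andbT.
apply/negPn/negP => /subvPn[z zB' zNB].
(* A vector [z] of [B'] outside [B] would give, with a basis of [B], four independent vectors in the
   kernel of a 7x7 matrix of rank at least 4. *)
have [u [v [w bB]]] := dim3_basis dimB.
have fX : free [tuple z; u; v; w] by rewrite /= free_cons (span_basis bB) zNB (basis_free bB).
have AM : (\matrix_(i < 4) tnth [tuple z; u; v; w] i) *m skewmx x y = 0.
  apply/row_matrixP => i; rewrite row_mul rowK row0 mul_skewmx.
  apply/rowP => j; rewrite !mxE.
  have := mem_tnth i [tuple z; u; v; w]; rewrite inE => /orP[/eqP->|uvw].
    by rewrite psiB'.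
  by rewrite psiB // (basis_mem bB).
have := mulmx0_rank_max AM; rewrite (eqP (row_free_of_free fX)).
by move/(leq_trans (leq_add (leqnn 4%N) (skewmx_rank fr))).
Qed.

Lemma bil_e (p : 'I_7) : exists2 m : F, m != 0 & forall x, bil (e F p) x = m * coord x p.
Proof.
exists (nth 0 [:: - a; - b; - c; a * b; b * c; - (a * b * c); c * a] p).
  by case: p => [[|[|[|[|[|[|[|//]]]]]]] ?]; rewrite /= ?oppr_eq0 ?mulf_neq0.
move=> x; rewrite /bil !coord_e //.
by case: p => [[|[|[|[|[|[|[|//]]]]]]] ?]; rewrite /=; ring.
Qed.

(** Apply [gram3_decomposition] with basis vectors for [u], [v], [w]: the right side vanishes, and
    the left side is a nonzero multiple of a minor of [x], [y], [z]. *)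
Lemma not_free_of_tensors_eq0 x y z : (forall j : 'I_7, psi x y z j = 0) -> phi x y z = 0 ->
  (forall u v, cross_tensor x y z u v + cross_tensor x y z v u = 0) -> ~~ free [:: x; y; z].
Proof.
move=> psi0 phi0 cross_tensor0; apply/negP => /minor3_neq0; apply=> i j k _.
have [mi nzi Ei] := bil_e i; have [mj nzj Ej] := bil_e j; have [mk nzk Ek] := bil_e k.
have := gram3_decomposition x y z (e F i) (e F j) (e F k).
have pd0 u v w : psi_dot x y z u v w = 0.
  have p0 n : (n < 7)%N -> psi x y z n = 0 by move=> lt_n; apply: (psi0 (Ordinal lt_n)).
  by rewrite /psi_dot !p0 //; ring.
have anti u v : cross_tensor x y z v u = - cross_tensor x y z u v.
  by apply/eqP; rewrite -addr_eq0 cross_tensor0.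
rewrite pd0 phi0 (anti (e F i)) (anti (e F j)) (anti (e F k)) !addrK mulr0 mul0r subr0 addr0 subrr.
rewrite !(Ei, Ej, Ek) => /eqP; rewrite mulf_eq0 (natrM F 2 2) mulf_eq0 (negbTE nz2) /= => g0.
apply/eqP; have := g0; rewrite (_ : _ - _ + _ = mi * mj * mk * minor3 x y z i j k).
  by rewrite !mulf_eq0 (negbTE nzi) (negbTE nzj) (negbTE nzk).
by rewrite /minor3 /minor2; ring.
Qed.

Lemma cross_dependent x y : free [:: x; y] -> ~~ free [:: cross x y; x; y] ->
  exists p q, cross x y = p *: x + q *: y.
Proof. by move=> fxy; rewrite free_cons fxy andbT negbK => /mem_span2P. Qed.

Lemma exists_free_cross eps B : frakB a b c eps B ->
  exists x y, [/\ x \in B, y \in B & free [:: cross x y; x; y]].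
Proof.
move=> /frakBP[dimB psi0]; have [x [y [z bB]]] := dim3_basis dimB.
have fr := basis_free bB.
have mB : {subset [:: x; y; z] <= B} by move=> v; apply: basis_mem.
have [xB yB zB] : [/\ x \in B, y \in B & z \in B] by split; apply: mB; rewrite !inE eqxx ?orbT.
pose pairs := [:: (x, y); (x, z); (y, z); (x, y + z); (y, x + z); (z, x + y)].
case: (boolP (has (fun p => free [:: cross p.1 p.2; p.1; p.2]) pairs)).
  case/hasP=> [[u v]] /= uv fruv; exists u, v; split=> //.
    by move: uv; rewrite !inE => /or4P[|||/or3P[]] /eqP[-> _].
  by move: uv; rewrite !inE => /or4P[|||/or3P[]] /eqP[_ ->]; rewrite ?memvD.
rewrite /= !negb_or => /and5P[dxy dxz dyz dx_yz /and3P[dy_xz dz_xy _]].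
have [[fxy fxz fyz] [fx_yz fy_xz fz_xy]] := free3_pairs fr.
have [p1 [p2 cxy]] := cross_dependent fxy dxy.
have [q1 [q3 cxz]] := cross_dependent fxz dxz.
have [r2 [r3 cyz]] := cross_dependent fyz dyz.
have [s1 [s2 cx]] := cross_dependent fx_yz dx_yz.
have [t1 [t2 cy]] := cross_dependent fy_xz dy_xz.
have [u1 [u2 cz]] := cross_dependent fz_xy dz_xy.
(* Expanding the three mixed pairs and comparing coefficients ties the separate constants
   together. *)
rewrite crossDr cxy cxz in cx; rewrite crossDr crossC cxy cyz in cy.
rewrite crossDr crossC cxz crossC cyz in cz.
have [_ e2 e3] : [/\ p1 + q1 - s1 = 0, p2 - s2 = 0 & q3 - s2 = 0].
  apply: (free3_eq0 fr); move/eqP: cx; rewrite -subr_eq0 => /eqP <-.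
  by apply/rowP => k; rewrite !mxE; ring.
have [e4 _ e5] : [/\ - p1 - t2 = 0, - p2 + r2 - t1 = 0 & r3 - t2 = 0].
  apply: (free3_eq0 fr); move/eqP: cy; rewrite -subr_eq0 => /eqP <-.
  by apply/rowP => k; rewrite !mxE; ring.
have [e6 e7 _] : [/\ - q1 - u2 = 0, - r2 - u2 = 0 & - q3 - r3 - u1 = 0].
  apply: (free3_eq0 fr); move/eqP: cz; rewrite -subr_eq0 => /eqP <-.
  by apply/rowP => k; rewrite !mxE; ring.
have {e2 e3} q3E : q3 = p2 by rewrite (subr0_eq e2) (subr0_eq e3).
have {e4 e5} r3E : r3 = - p1 by rewrite (subr0_eq e4) (subr0_eq e5).
have {e6 e7} r2E : r2 = q1 by apply: oppr_inj; rewrite (subr0_eq e6) (subr0_eq e7).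
(* The linear form [f] of the overview has values [f(x) = p2], [f(y) = - p1], [f(z) = - q1]. *)
rewrite q3E {q3 q3E cx cz} in cxz; rewrite r3E r2E {r2 r3 r2E r3E cy} in cyz.
have czx : cross z x = - q1 *: x - p2 *: z by rewrite crossC cxz opprD scaleNr.
have phixy : phi x y z = p1 * bil x z + p2 * bil y z.
  by rewrite /phi cxy bilDl !bilZl.
have phiyz : phi x y z = q1 * bil x y - p1 * bil x z.
  by rewrite -phi_cyc /phi cyz bilDl !bilZl (bilC y) (bilC z); ring.
have phizx : phi x y z = - q1 * bil x y - p2 * bil y z.
  by rewrite -2!phi_cyc /phi czx bilDl -scaleNr !bilZl (bilC z); ring.
have xyx : p1 * bil x x + p2 * bil x y = 0.
  by rewrite -(bil_crossl x y) cxy bilDl !bilZl (bilC y).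
have xyy : p1 * bil x y + p2 * bil y y = 0.
  by rewrite -(bil_crossr x y) cxy bilDl !bilZl.
have xzx : q1 * bil x x + p2 * bil x z = 0.
  by rewrite -(bil_crossl x z) cxz bilDl !bilZl (bilC z).
have yzy : q1 * bil y y - p1 * bil y z = 0.
  by rewrite -(bil_crossl y z) cyz bilDl !bilZl (bilC z) mulNr.
have p1phi : p1 * phi x y z = 0.
  transitivity (- q1 * (p1 * bil x y + p2 * bil y y) + p2 * (q1 * bil y y - p1 * bil y z)).
    by rewrite phizx; ring.
  by rewrite xyy yzy !mulr0 addr0.
have p2phi : p2 * phi x y z = 0.
  transitivity (q1 * (p1 * bil x x + p2 * bil x y) - p1 * (q1 * bil x x + p2 * bil x z)).
    by rewrite phiyz; ring.
  by rewrite xyx xzx !mulr0 subr0.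
(* A nonzero [phi x y z] would force [p1 = p2 = 0], and then [phixy] makes it zero. *)
have phi0 : phi x y z = 0.
  apply/eqP/negPn/negP => nz_phi; move/eqP: p1phi; move/eqP: p2phi.
  rewrite !mulf_eq0 (negbTE nz_phi) !orbF => /eqP p20 /eqP p10.
  by move: nz_phi; rewrite phixy p10 p20 !mul0r addr0 eqxx.
(* After substitution the tensor is [q1 (x ⊗ y - y ⊗ x) + p1 (z ⊗ x - x ⊗ z) + p2 (z ⊗ y - y ⊗
   z)]. *)
have anti u v : cross_tensor x y z u v + cross_tensor x y z v u = 0.
  by rewrite /cross_tensor cxy cyz czx !bilDr -?scaleNr !bilZr; ring.
by have := not_free_of_tensors_eq0 (psi0 _ _ _ xB yB zB) phi0 anti; rewrite fr.
Qed.

(** A cross product lying in the span of [x] and [y] is orthogonal to itself, hence zero; then the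
    Gram determinant of [x], [y] vanishes, which anisotropy excludes for independent vectors. *)
Lemma free_cross_aniso x y : (forall z, bil z z = 0 -> z = 0) ->
  free [:: x; y] -> free [:: cross x y; x; y].
Proof.
move=> aniso fxy; rewrite free_cons fxy andbT; apply/negP => /mem_span2P[p [q crossE]].
have cross0 : cross x y = 0.
  by apply: aniso; rewrite {2}crossE bilDr !bilZr bil_crossl bil_crossr !mulr0 addr0.
have gram0 : bil x x * bil y y - bil x y ^+ 2 = 0.
  by rewrite -bil_cross_cross cross0 -(scale0r 0) bilZl mul0r.
(* This vector has norm [bil x x] times the Gram determinant. *)
have /(proj1 (free2P x y) fxy)[_ /eqP] : bil x y *: x + (- bil x x) *: y = 0.
  apply: aniso; rewrite bilDl !bilDr !bilZl !bilZr (bilC y x).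
  transitivity (bil x x * (bil x x * bil y y - bil x y ^+ 2)); first by ring.
  by rewrite gram0 mulr0.
rewrite oppr_eq0 => /eqP/aniso x0.
by have := free_not0 fxy (mem_head x _); rewrite x0 eqxx.
Qed.
End Fano.
End Minors.

Theorem mainTheorem4 (F : fieldType) (a b c : F) (eps : bool) :
  2%N \notin [pchar F] -> a != 0 -> b != 0 -> c != 0 ->
  minimal_q_covering 3 2 (frakB a b c eps) /\
  ((forall l : 'I_8 -> F, octonion_form a b c l = 0 -> forall i, l i = 0) ->
   subspace_design_2_7_3_1 (frakB a b c eps)).
Proof.
rewrite inE /= => nz2 nza nzb nzc.
have cover := @frakB_covering F a b c nz2 eps; split.
  split=> // S' S'B [_ cover'] B frB.
  (* [B] is the only block containing this pair, so any subfamily that covers the span of [x] and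
     [y] must contain [B]. *)
  have [x [y [xB yB fr]]] := exists_free_cross nz2 nza nzb nzc frB.
  have fxy : free [:: x; y] by move: fr; rewrite free_cons => /andP[].
  have [B' [S'B' TB']] := cover' <<[:: x; y]>>%VS (eqP fxy).
  rewrite -(frakB_unique fr frB (S'B _ S'B')) //;
    by apply: (subvP TB'); apply: memv_span; rewrite !inE eqxx ?orbT.
move=> aniso; case: cover => dim3 cover; split=> // T dimT.
have [B [frB TB]] := cover T dimT; exists B; split=> // B' frB' TB'.
have [x [y bT]] := dim2_basis dimT.
have [xT yT] : x \in T /\ y \in T by split; apply: (basis_mem bT); rewrite !inE eqxx ?orbT.
have fr : free [:: cross a b c x y; x; y].
  apply: free_cross_aniso (basis_free bT) => z Nz.
  (* The real coordinate is 0. The last two entries are exchanged because [v_6] has norm [c * a] and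
     [v_5] has norm [- a * b * c]. *)
  pose l (i : 'I_8) := nth 0 [:: 0; coord z 0; coord z 1; coord z 2; coord z 3;
                                 coord z 4; coord z 6; coord z 5] i.
  have l0 : forall i, l i = 0 by apply: aniso; rewrite -[RHS]Nz /octonion_form /bil /l /=; ring.
  apply/rowP => k; rewrite coordE mxE.
  by case: k => [[|[|[|[|[|[|[|//]]]]]]] ?];
    [exact: (l0 1) | exact: (l0 2) | exact: (l0 3) | exact: (l0 4) | exact: (l0 5)
    | exact: (l0 7) | exact: (l0 6)].
by apply: (frakB_unique fr frB frB'); apply: subvP; eassumption.
Qed.
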